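(* Let $f \in \mathbb{C}[x_1,\dots,x_n]_d$ with $\underline{\mathsf{WR}}(f) = r$. Then $\mathsf{WR}(f) \le \binom{2r-2}{r-1}\cdot d$.
   Context: $\mathsf{WR}(f)$ is the Waring rank: the smallest $s$ with $f=\sum_{k=1}^s\ell_k^d$ for linear forms $\ell_k$. $\underline{\mathsf{WR}}(f)$ is the border Waring rank: the smallest $s$ with $f=\lim_{\epsilon\to0}\sum_{k=1}^s\ell_k(\epsilon)^d$ for linear forms $\ell_k(\epsilon)$ whose coefficients are rational functions of $\epsilon$.
   Formalization: The degree d is assumed to be at least 1; for d = 0 the claim fails, since the constant f = 1 has Waring rank and border Waring rank 1 while the bound is 0. *)

(* Defs.v *)
From HB Require Import structures.
From mathcomp Require Import all_boot all_order all_algebra.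
From mathcomp Require Import reals.
From mathcomp Require Import complex.
From mathcomp Require Import mpoly.
Set Implicit Arguments. Unset Strict Implicit. Unset Printing Implicit Defensive.
Import Order.TTheory GRing.Theory Num.Theory.
Local Open Scope ring_scope.

Definition linform (C : comNzRingType) (n : nat) (a : 'I_n -> C) : {mpoly C[n]} :=
  \sum_(i < n) a i *: 'X_i.

Definition waring_decomp (C : comNzRingType) (n d : nat) (f : {mpoly C[n]}) (s : nat) :=
  exists l : 'I_s -> 'I_n -> C, f = \sum_(k < s) (linform (l k)) ^+ d.

Record ratfun (C : idomainType) := RatFun { rnum : {poly C}; rden : {poly C};
                                            rden_neq0 : rden != 0 }.
Definition reval (C : fieldType) (q : ratfun C) (e : C) : C :=
  (rnum q).[e] / (rden q).[e].

(* Border Waring decomposition of length s over C = R[i]: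
   f = lim_{eps -> 0} sum_{k<s} l_k(eps)^d where the coefficients of the
   linear forms l_k(eps) are rational functions of eps; the limit is taken
   coefficientwise in the Euclidean topology of C (epsilon-delta, over the
   punctured neighbourhood of 0 minus the finitely many poles). *)
Definition border_decomp (R : realType) (n d : nat) (f : {mpoly R[i][n]}) (s : nat) :=
  exists l : 'I_s -> 'I_n -> ratfun R[i],
  forall e : R, 0 < e -> exists2 delta : R, 0 < delta &
    forall eps : R[i], eps != 0 -> `|eps| < (delta%:C)%C ->
      (forall k i, (rden (l k i)).[eps] != 0) ->
      forall m : 'X_{1..n},
        `| (\sum_(k < s) (linform (fun i => reval (l k i) eps)) ^+ d)@_m - f@_m | < (e%:C)%C.

Definition WR_le (R : realType) (n d : nat) (f : {mpoly R[i][n]}) (N : nat) :=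
  exists2 s, (s <= N)%N & waring_decomp d f s.

Definition BWR_eq (R : realType) (n d : nat) (f : {mpoly R[i][n]}) (r : nat) :=
  border_decomp d f r /\ forall s, (s < r)%N -> ~ border_decomp d f s.

(* Main.v *)
Require Import Defs.
From HB Require Import structures.
From mathcomp Require Import all_boot all_order all_algebra.
From mathcomp Require Import reals complex mpoly.
From mathcomp Require Import ring zify.
Set Implicit Arguments. Unset Strict Implicit. Unset Printing Implicit Defensive.
Import Order.TTheory GRing.Theory Num.Theory.
Local Open Scope ring_scope.

(* A form [f] of degree [d] is handled through the functional on forms [p] of
   degree [d] for which a power [l ^+ d] corresponds to evaluation of [p] at [l].
   A border decomposition then says that the functional [phi] of [f] is, up to a
   constant, the coefficient of [eps^N] in [\sum_k p(Q_k)] for points [Q_k] with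
   polynomial coordinates, and by duality [f] is a combination of the powers of
   linear forms in a set [Z] as soon as every [p] vanishing on [Z] is killed by
   [phi].

   If a linear form with coefficients in [C[eps]] vanishes at all [Q_k], a
   variable can be eliminated, so one may assume at most [r] variables.  If
   [d < r], a set [Z] unisolvent for forms of degree [d] is small enough.  If
   [d >= r], group the [Q_k] by their limit point [b], with [m_b] of them tending
   to [b].  Products of linear forms through moving points show that each group
   sum is itself divisible by [eps^N]: a form [U] killing the other groups with
   [U(b) != 0] is invertible modulo the [m_b]-th power of the ideal of [b], and
   that power contributes only to higher order.  Hence [phi] kills every [p]
   vanishing to order [m_b] at each [b].  Vanishing to order [m_b] at [b] is
   forced by vanishing at [b] and at [d] further points on each of
   ['C(n + m_b - 2, m_b - 1) - 1] lines through [b].  The bound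
   ['C(n + m_b - 2, m_b - 1) * d] is superadditive in [m_b], and the [m_b] sum to
   [r]. *)

(** * Homogeneous polynomials and linear forms *)

Lemma dhomog_ind (A : comNzRingType) n e (G : {mpoly A[n]} -> Prop) :
    G 0 -> (forall p q, G p -> G q -> G (p + q)) ->
    (forall c m, mdeg m = e -> G (c *: 'X_[m])) ->
  forall p, p \is e.-homog -> G p.
Proof.
move=> G0 GD GX p /dhomogP hp; rewrite (mpolyE p) big_seq.
by elim/big_ind: _ => // m /hp /GX.
Qed.

Lemma mdegS_neq0 n e (m : 'X_{1..n}) : mdeg m = e.+1 -> exists i, (0 < m i)%N.
Proof.
move=> hm; apply/existsP; apply: contra_eqT hm; rewrite negb_exists => /forallP h.
by rewrite mdegE big1 // => i _; apply/eqP; move: (h i); case: (m i).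
Qed.

Lemma mdegS_subU n e (m : 'X_{1..n}) i : mdeg m = e.+1 -> (0 < m i)%N ->
  m = (U_(i) + (m - U_(i)))%MM /\ mdeg (m - U_(i))%MM = e.
Proof.
move=> hm hi; have em : m = (U_(i) + (m - U_(i)))%MM.
  apply/mnmP => k; rewrite mnmDE mnmBE mnm1E subnKC //.
  by case: eqP => // <-.
by split=> //; apply/eqP; rewrite -eqSS -hm {2}em mdegD mdeg1.
Qed.

Lemma dhomog_sum (A : comNzRingType) n e (I : Type) (s : seq I) (P : pred I)
    (g : I -> {mpoly A[n]}) :
  (forall i, P i -> g i \is e.-homog) -> \sum_(i <- s | P i) g i \is e.-homog.
Proof. by move=> h; apply: rpred_sum. Qed.

Lemma dhomogU (A : comNzRingType) n (i : 'I_n) : ('X_i : {mpoly A[n]}) \is 1.-homog.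
Proof. by rewrite dhomogX /= mdeg1. Qed.

Lemma dhomogC (A : comNzRingType) n (c : A) : (c%:MP : {mpoly A[n]}) \is 0.-homog.
Proof. by rewrite -[_%:MP]mulr1 mul_mpolyC dhomogZ // dhomog1. Qed.

Lemma dhomog_linform (A : comNzRingType) n (a : 'I_n -> A) : linform a \is 1.-homog.
Proof. by apply: dhomog_sum => i _; apply/dhomogZ/dhomogU. Qed.

Lemma meval_linform (A : comNzRingType) n (a x : 'I_n -> A) :
  (linform a).@[x] = \sum_i a i * x i.
Proof.
rewrite /linform rmorph_sum /=; apply: eq_bigr => i _.
by rewrite mevalZ mevalXU.
Qed.

Lemma mcoeff_linform (A : comNzRingType) n (a : 'I_n -> A) i :
  (linform a)@_U_(i) = a i.
Proof.
rewrite /linform raddf_sum (bigD1 i) //= mcoeffZ mcoeffX eqxx mulr1.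
rewrite big1 ?addr0 // => j ne_ji; rewrite mcoeffZ mcoeffX.
by rewrite eq_mnm1 (negbTE ne_ji) mulr0.
Qed.

Lemma linformZ (A : comNzRingType) n c (a : 'I_n -> A) :
  linform (fun i => c * a i) = c *: linform a.
Proof. by rewrite /linform scaler_sumr; apply: eq_bigr => i _; rewrite scalerA. Qed.

Lemma meval_dhomogZ (A : comNzRingType) n e (p : {mpoly A[n]}) c (x : 'I_n -> A) :
  p \is e.-homog -> p.@[fun i => c * x i] = c ^+ e * p.@[x].
Proof.
move: p; apply: dhomog_ind => [|p q hp hq|a m <-]; first by rewrite !meval0 mulr0.
  by rewrite !mevalD hp hq mulrDr.
rewrite !mevalZ !mevalX mulrCA; congr (_ * _).
under eq_bigr do rewrite exprMn; rewrite big_split /=; congr (_ * _).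
by rewrite mdegE prodrXr.
Qed.

Lemma dhomog_comp (A : comNzRingType) n k e (p : {mpoly A[n]})
    (g : 'I_n -> {mpoly A[k]}) :
    (forall i, g i \is 1.-homog) -> p \is e.-homog ->
  p \mPo [tuple g i | i < n] \is e.-homog.
Proof.
move=> hg; move: p; apply: dhomog_ind => [|p q hp hq|a m <-].
- by rewrite comp_mpoly0 dhomog0.
- by rewrite comp_mpolyD dhomogD.
rewrite comp_mpolyZ dhomogZ // comp_mpolyX mdegE.
elim/big_ind2: _ => [|????|i _]; [exact: dhomog1|exact: dhomogM|].
by rewrite tnth_mktuple -{2}[m i]mul1n; apply/dhomogMn.
Qed.

Lemma size_mmap_dhomog (F : idomainType) n e (p : {mpoly F[n]}) (x : 'I_n -> {poly F}) :
    (forall i, (size (x i) <= 2)%N) -> p \is e.-homog ->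
  (size (mmap polyC x p) <= e.+1)%N.
Proof.
move=> hx; move: p; apply: dhomog_ind => [|p q hp hq|a m <-].
- by rewrite mmap0 size_poly0.
- by rewrite mmapD (leq_trans (size_polyD _ _)) // geq_max hp hq.
rewrite mmapZ mul_polyC (leq_trans (size_scale_leq _ _)) //.
rewrite mmapX mdegE /mmap1.
elim/big_ind2: _ => [|p i q j hp hq|i _]; first by rewrite size_poly1.
  rewrite (leq_trans (size_polyMleq _ _)) //.
  by have := leq_add hp hq; rewrite addnS addSn; case: (_ + _)%N.
rewrite (leq_trans (size_poly_exp_leq _ _)) // ltnS.
have: ((size (x i)).-1 <= 1)%N by case: (size _) (hx i).
by move=> h; rewrite -{2}[m i]mul1n leq_mul2r h orbT.
Qed.

(* [vord t b j e p]: [p] is homogeneous of degree [e] and lies in the [j]-th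
   power of the ideal of the projective point [b], where [t] is a linear form
   with [t(b) = 1]; the forms ['X_i - b i *: t] generate that ideal. *)
Fixpoint vord (A : comNzRingType) n (t : {mpoly A[n]}) (b : 'I_n -> A) (j e : nat)
    (p : {mpoly A[n]}) : Prop :=
  match j, e with
  | 0, _ => p \is e.-homog
  | j'.+1, 0 => p = 0
  | j'.+1, e'.+1 => exists2 g : 'I_n -> {mpoly A[n]},
      forall i, vord t b j' e' (g i) & p = \sum_i ('X_i - b i *: t) * g i
  end.

(** * Powers of the ideal of a point *)

Section VanishingOrder.

Variables (F : numFieldType) (n : nat) (a b : 'I_n -> F).
Local Notation t := (linform a).
Hypothesis tb : t.@[b] = 1.
Local Notation Y i := ('X_i - b i *: t).
Local Notation vord := (vord t b).

Lemma dhomogY i : Y i \is 1.-homog.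
Proof.
have -> : Y i = 'X_i + (- b i) *: t by rewrite scaleNr.
by rewrite dhomogD ?dhomogU ?dhomogZ ?dhomog_linform.
Qed.

Lemma mevalY x i : (Y i).@[x] = x i - b i * t.@[x].
Proof. by rewrite mevalB mevalZ mevalXU. Qed.

Lemma vord_homog j e p : vord j e p -> p \is e.-homog.
Proof.
elim: j e p => [|j IH] [|e] p //=; first by move->; exact: dhomog0.
case=> g hg ->; apply: dhomog_sum => i _; rewrite -add1n.
by apply: dhomogM; [exact: dhomogY | exact: IH].
Qed.

Lemma vord_0 j e : vord j e 0.
Proof.
elim: j e => [|j IH] [|e] //=; try exact: dhomog0.
by exists (fun=> 0) => //; rewrite big1 // => i _; rewrite mulr0.
Qed.

Lemma vordD j e p q : vord j e p -> vord j e q -> vord j e (p + q).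
Proof.
elim: j e p q => [|j IH] [|e] p q /=; try exact: dhomogD.
  by move=> -> ->; rewrite addr0.
case=> g hg -> [h hh ->]; exists (fun i => g i + h i) => [i|]; first exact: IH.
by rewrite -big_split; apply: eq_bigr => i _; rewrite /= mulrDr.
Qed.

Lemma vordZ j e c p : vord j e p -> vord j e (c *: p).
Proof.
elim: j e p => [|j IH] [|e] p /=; try exact: dhomogZ.
  by move=> ->; rewrite scaler0.
case=> g hg ->; exists (fun i => c *: g i) => [i|]; first exact: IH.
by rewrite scaler_sumr; apply: eq_bigr => i _; rewrite scalerAr.
Qed.

Lemma vordM j e k p q : vord j e p -> q \is k.-homog -> vord j (e + k) (p * q).
Proof.
elim: j e p => [|j IH] [|e] p /=; try by apply: dhomogM.
  by move=> -> _; rewrite mul0r; apply: (vord_0 j.+1).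
case=> g hg -> hq; exists (fun i => g i * q) => [i|]; first exact: IH.
by rewrite mulr_suml; apply: eq_bigr => i _; rewrite mulrA.
Qed.

Lemma vordY j e p i : vord j e p -> vord j.+1 e.+1 (Y i * p).
Proof.
move=> hp; exists (fun k => if k == i then p else 0) => [k|].
  by case: eqP => // _; exact: vord_0.
rewrite (bigD1 i) //= eqxx big1 ?addr0 // => k /negbTE ->.
by rewrite mulr0.
Qed.

(** Modulo the forms [Y i], each variable ['X_i] equals [b i *: t], so a form of degree [e] reduces
    to its value at [b] times [t ^+ e]. *)
Lemma vord_vanish e p : p \is e.-homog -> vord 1 e (p - p.@[b] *: t ^+ e).
Proof.
move: p; apply: dhomog_ind => [|p q hp hq|c m hm].
- by rewrite meval0 scale0r subrr; apply: vord_0.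
- by rewrite mevalD scalerDl opprD addrACA; apply: vordD.
rewrite mevalZ -scalerA -scalerBr; apply: vordZ.
elim: e m hm => [|e IH] m hm.
  have -> : m = 0%MM by apply/eqP; rewrite -mdeg_eq0 hm.
  by rewrite mpolyX0 meval1 scale1r expr0 subrr.
have [i hi] := mdegS_neq0 hm; have [em hm'] := mdegS_subU hm hi.
rewrite em mpolyXD mevalM mevalXU; have := IH _ hm'.
set X := 'X_[_]; set c' := X.@[b] => hX.
have -> : 'X_i * X - (b i * c') *: t ^+ e.+1 =
    (X - c' *: t ^+ e) * 'X_i + c' *: (Y i * t ^+ e).
  rewrite exprS -!mul_mpolyC mpolyCM; ring.
apply: vordD; first by rewrite -[e.+1]addn1; apply: (vordM hX); exact: dhomogU.
apply/vordZ/vordY; rewrite -[e in vord _ e]mul1n.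
exact/dhomogMn/dhomog_linform.
Qed.

Lemma dhomog_tX e : t ^+ e \is e.-homog.
Proof. by rewrite -[e in e.-homog]mul1n; apply/dhomogMn/dhomog_linform. Qed.

(* [U] is invertible modulo the [j+1]-st power of the ideal of [b]. *)
Lemma vord_divide u U j e p : U \is u.-homog -> U.@[b] != 0 ->
    vord j e p -> (j + u <= e)%N ->
  exists2 q, q \is (e - u).-homog & vord j.+1 e (p - U * q).
Proof.
move=> hU Ub; elim: j e p => [|j IH] e p.
  move=> hp; rewrite add0n => le_ue.
  exists ((p.@[b] / U.@[b]) *: t ^+ (e - u)); first exact/dhomogZ/dhomog_tX.
  set q := _ *: _; have hr : p - U * q \is e.-homog.
    rewrite rpredB // -(subnKC le_ue); apply: dhomogM => //.
    exact/dhomogZ/dhomog_tX.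
  have := vord_vanish hr; rewrite mevalB mevalM mevalZ rmorphXn /= tb expr1n.
  by rewrite mulr1 mulrCA divff // mulr1 subrr scale0r subr0.
case: e => [|e] // [g hg ->]; rewrite addSn ltnS => le_e.
have /fin_all_exists2 [h hh hgh] i := IH _ _ (hg i) le_e.
exists (\sum_i Y i * h i).
  apply: dhomog_sum => i _; rewrite subSn ?(leq_trans (leq_addl _ _) le_e) // -add1n.
  by apply: dhomogM => //; apply: dhomogY.
exists (fun i => g i - U * h i) => //.
rewrite mulr_sumr -sumrB; apply: eq_bigr => i _.
by rewrite mulrBr mulrCA.
Qed.

(** This is the leading term of a Taylor expansion at [b]: the [Y i] act as local coordinates, and
    [t ^+ (e - j)], equal to 1 at [b], restores the degree. *)
Lemma vord_leading j e p : vord j e p -> (j <= e)%N ->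
  exists2 G : {mpoly F[n]}, G \is j.-homog &
    vord j.+1 e (p - t ^+ (e - j) * (G \mPo [tuple Y i | i < n])).
Proof.
elim: j e p => [|j IH] e p.
  move=> hp _; exists (p.@[b])%:MP; first exact: dhomogC.
  by rewrite comp_mpolyC subn0 mulrC mul_mpolyC; apply: vord_vanish.
case: e => [|e] // [g hg ->]; rewrite ltnS => le_e.
have /fin_all_exists2 [h hh hgh] i := IH _ _ (hg i) le_e.
exists (\sum_i 'X_i * h i).
  by apply: dhomog_sum => i _; rewrite -add1n; apply: dhomogM => //; apply: dhomogU.
exists (fun i => g i - t ^+ (e - j) * (h i \mPo [tuple Y i | i < n])) => //.
rewrite rmorph_sum mulr_sumr -sumrB; apply: eq_bigr => i _.
rewrite rmorphM /= comp_mpolyXU -tnth_nth tnth_mktuple subSS.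
by rewrite mulrBr mulrCA.
Qed.

End VanishingOrder.

(** * Order of vanishing tested on lines through the point *)

Definition vanish_on (F : fieldType) n (Z : seq {ffun 'I_n -> F}) (p : {mpoly F[n]}) :=
  forall z : {ffun 'I_n -> F}, z \in Z -> p.@[z] = 0.

Lemma horner_mmap (F : comNzRingType) n (x : 'I_n -> {poly F}) (p : {mpoly F[n]}) s :
  (mmap polyC x p).[s] = p.@[fun i => (x i).[s]].
Proof.
rewrite mevalE /mmap horner_sum; apply: eq_bigr => m _.
rewrite hornerM hornerC; congr (_ * _); rewrite /mmap1 horner_prod.
by apply: eq_bigr => i _; rewrite horner_exp.
Qed.

Section Lines.

Variables (F : numFieldType) (n : nat) (a b : 'I_n -> F).
Local Notation t := (linform a).
Hypothesis tb : t.@[b] = 1.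
Local Notation Y i := ('X_i - b i *: t).
Local Notation Yt := [tuple Y i | i < n].
Local Notation vord := (vord t b).
Local Notation line z := (fun i => (b i)%:P + (z i)%:P * 'X).

Lemma line_linform (z : 'I_n -> F) : mmap polyC (line z) t = 1 + (t.@[z])%:P * 'X.
Proof.
rewrite /linform raddf_sum /=.
transitivity (\sum_i ((a i * b i)%:P + (a i * z i)%:P * 'X) : {poly F}).
  apply: eq_bigr => i _; rewrite mmapZ mmapX mmap1U mulrDr mulrA.
  by rewrite -!polyCM.
rewrite big_split /= -mulr_suml -!raddf_sum /= -!meval_linform.
by rewrite tb.
Qed.

Lemma line_Y (z : 'I_n -> F) i : mmap polyC (line z) (Y i) = 'X * ((Y i).@[z])%:P.
Proof.
rewrite mmapB mmapZ line_linform mmapX mmap1U (mevalY a b z i).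
rewrite polyCB polyCM; ring.
Qed.

Lemma vord_line (z : 'I_n -> F) j e p : vord j e p ->
  exists r, mmap polyC (line z) p = 'X^j * r.
Proof.
elim: j e p => [|j IH] [|e] p /=.
- by exists (mmap polyC (line z) p); rewrite mul1r.
- by exists (mmap polyC (line z) p); rewrite mul1r.
- by move->; exists 0; rewrite mmap0 mulr0.
case=> g hg ->; have /fin_all_exists [h hh] i := IH _ _ (hg i).
exists (\sum_i ((Y i).@[z])%:P * h i); rewrite raddf_sum mulr_sumr.
apply: eq_bigr => i _ /=; rewrite rmorphM /= line_Y hh exprS; ring.
Qed.

Lemma line_comp (z : 'I_n -> F) j (G : {mpoly F[n]}) : G \is j.-homog ->
  mmap polyC (line z) (G \mPo Yt) = 'X^j * ((G \mPo Yt).@[z])%:P.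
Proof.
move: G; apply: dhomog_ind => [|p q hp hq|c m <-].
- by rewrite comp_mpoly0 mmap0 meval0 mulr0.
- by rewrite comp_mpolyD mmapD hp hq mevalD polyCD mulrDr.
rewrite comp_mpolyZ mmapZ mevalZ polyCM mulrCA; congr (_ * _).
rewrite comp_mpolyX mdegE !rmorph_prod /= -prodrXr -big_split.
by apply: eq_bigr => i _; rewrite !rmorphXn /= tnth_mktuple line_Y exprMn.
Qed.

(** Along the line, [t] has constant term 1 and the leading term becomes ['X^j] times its value at
    [z]; comparing coefficients of ['X^j] gives the claim. *)
Lemma vord_line_leading (z : 'I_n -> F) j e p (G : {mpoly F[n]}) :
    mmap polyC (line z) p = 0 -> G \is j.-homog ->
    vord j.+1 e (p - t ^+ (e - j) * (G \mPo Yt)) ->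
  (G \mPo Yt).@[z] = 0.
Proof.
move=> p0 hG /vord_line -/(_ z) [r]; rewrite mmapB rmorphM rmorphXn /=.
rewrite line_linform (line_comp _ hG) p0 sub0r => /(congr1 (fun q : {poly F} => q`_j)).
rewrite coefN mulrCA coefXnM ltnn subnn coefXnM ltnSn => /eqP.
rewrite oppr_eq0 coefMC -horner_coef0 horner_exp !hornerE /= => /eqP.
by rewrite expr1n mul1r.
Qed.

Lemma line_vanish (z : 'I_n -> F) d p : p \is d.-homog ->
    (forall s, (s <= d)%N -> p.@[fun i => b i + s%:R * z i] = 0) ->
  mmap polyC (line z) p = 0.
Proof.
move=> hp p0; pose rs := [seq s%:R : F | s <- iota 0 d.+1].
apply: (@roots_geq_poly_eq0 _ _ rs).
- apply/allP => x /mapP [s]; rewrite mem_iota add0n ltnS => /p0 h ->.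
  rewrite rootE horner_mmap -[X in _ == X]h; apply/eqP/meval_eq => i.
  by rewrite !hornerE mulrC.
- by rewrite map_inj_uniq ?iota_uniq // => x y /eqP; rewrite eqr_nat => /eqP.
rewrite size_map size_iota; apply: size_mmap_dhomog hp => i.
rewrite (leq_trans (size_polyD _ _)) // geq_max (leq_trans (size_polyC_leq1 _)) //=.
by rewrite mul_polyC (leq_trans (size_scale_leq _ _)) // size_polyX.
Qed.

Lemma linform_neq0 : t != 0.
Proof.
by apply/eqP => t0; move: tb; rewrite t0 meval0 => /eqP; rewrite eq_sym oner_eq0.
Qed.

(** On a line, a form of degree [d] is tested at [d.+1] points; [b], common to all the lines, is
    listed once. *)
Definition line_points d (M : seq {ffun 'I_n -> F}) : seq {ffun 'I_n -> F} :=
  finfun b :: [seq [ffun i => b i + s%:R * z i] | z : {ffun _ -> _} <- M, s <- iota 1 d].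

Lemma size_line_points d M : size (line_points d M) = (size M * d).+1.
Proof. by rewrite /= size_allpairs size_iota. Qed.

(** By induction on [j]: the leading term of order [j] vanishes at [b] and at all directions in [M],
    hence is zero, and the order rises by one. *)
Lemma vord_of_points m d (M : seq {ffun 'I_n -> F}) p : (m < d)%N ->
    (forall q : {mpoly F[n]}, q \is m.-homog -> q.@[b] = 0 ->
      vanish_on M q -> q = 0) ->
    p \is d.-homog -> vanish_on (line_points d M) p ->
  vord m.+1 d p.
Proof.
move=> lt_md hM hp hZ.
have pb : p.@[b] = 0.
  by rewrite -[RHS](hZ (finfun b)) ?mem_head //; apply: meval_eq => i; rewrite ffunE.
have pbz z : p.@[fun i => b i + 0%:R * z i] = 0.
  by rewrite -[RHS]pb; apply: meval_eq => i; rewrite mul0r addr0.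
(* The line in direction [b] consists of multiples of [b], where [p] vanishes by homogeneity. *)
have lb : mmap polyC (line b) p = 0.
  apply: (line_vanish hp) => s _.
  rewrite -[RHS](mulr0 ((1 + s%:R) ^+ d)) -[in RHS]pb -(meval_dhomogZ _ _ hp).
  by apply: meval_eq => i; rewrite mulrDl mul1r.
have lz : forall z : {ffun 'I_n -> F}, z \in M -> mmap polyC (line z) p = 0.
  move=> z zM; apply: (line_vanish hp) => -[|s] le_sd; first exact: pbz.
  rewrite -[RHS](hZ [ffun i => b i + s.+1%:R * z i]).
    by apply: meval_eq => i; rewrite ffunE.
  rewrite inE (allpairs_f (fun (z : {ffun 'I_n -> F}) s =>
    [ffun i => b i + s%:R * z i])) ?orbT //.
  by rewrite mem_iota add1n ltnS.
suff: forall j, (j <= m.+1)%N -> vord j d p by apply.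
elim=> [|j IH] // lt_jm.
have le_jd : (j <= d)%N by lia.
have [G hG hpG] := vord_leading (IH (ltnW lt_jm)) le_jd.
have hGY : G \mPo Yt \is j.-homog by apply: dhomog_comp => // i; apply: dhomogY.
suff GY0 : G \mPo Yt = 0 by move: hpG; rewrite GY0 mulr0 subr0.
(* The factor [t ^+ (m - j)] raises the degree to [m], the one to which [hM] applies. *)
have /eqP : t ^+ (m - j) * (G \mPo Yt) = 0.
  apply: hM.
  - rewrite -[m in m.-homog](@subnK j) //; apply: dhomogM => //; exact: dhomog_tX.
  - by rewrite mevalM (vord_line_leading lb hG hpG) mulr0.
  by move=> z /lz pz; rewrite mevalM (vord_line_leading pz hG hpG) mulr0.
by rewrite mulf_eq0 expf_eq0 (negbTE linform_neq0) andbF => /eqP.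
Qed.

End Lines.

(** * Unisolvent point sets for forms *)

Lemma expand_inj n K (u v : 'I_n -> nat) :
    (forall i, u i < K)%N -> (forall i, v i < K)%N ->
  (\sum_i u i * K ^ i = \sum_i v i * K ^ i)%N -> u =1 v.
Proof.
elim: n u v => [|n IH] u v hu hv; first by move=> _ [].
have K0 : (0 < K)%N by apply: leq_ltn_trans (hu ord0).
rewrite !big_ord_recl /= !expn0 !muln1.
have E (w : 'I_n.+1 -> nat) :
    (\sum_(i < n) w (lift ord0 i) * K ^ lift ord0 i =
     (\sum_(i < n) w (lift ord0 i) * K ^ i) * K)%N.
  by rewrite big_distrl; apply: eq_bigr => i _ /=; rewrite expnS mulnCA mulnC.
rewrite !E => h; have h0 : u ord0 = v ord0.
  have := congr1 (modn^~ K) h.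
  by rewrite /= !(addnC (_ ord0)) !modnMDl !modn_small.
move: h; rewrite h0 => /addnI /eqP; rewrite eqn_pmul2r // => /eqP h i.
case: (unliftP ord0 i) => [j|] -> //.
exact: (IH (fun j => u (lift ord0 j)) (fun j => v (lift ord0 j))).
Qed.

Lemma poly_nonroot (F : numFieldType) (p : {poly F}) : p != 0 ->
  exists k : nat, p.[k%:R] != 0.
Proof.
move=> p0; pose rs := [seq k%:R : F | k <- iota 0 (size p)].
have : ~~ all (root p) rs.
  apply: contra p0 => h; apply/eqP/(roots_geq_poly_eq0 h).
    by rewrite map_inj_uniq ?iota_uniq // => x y /eqP; rewrite eqr_nat => /eqP.
  by rewrite size_map size_iota.
by rewrite -has_predC => /hasP [_ /mapP [k _ ->] hk]; exists k.
Qed.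

(* Kronecker substitution ['X_i := 'X^(K ^ i)] with [K] above all exponents. *)
Lemma mpoly_nonroot (F : numFieldType) n (p : {mpoly F[n]}) : p != 0 ->
  exists x : {ffun 'I_n -> F}, p.@[x] != 0.
Proof.
move=> p0; pose K := msize p; pose q := mmap polyC (fun i : 'I_n => 'X^(K ^ i)) p.
have mK m : m \in msupp p -> forall i, (m i < K)%N.
  move=> hm i; apply: leq_ltn_trans (msize_mdeg_lt hm).
  by rewrite mdegE (bigD1 i) //= leq_addr.
have [k hk] : exists k : nat, q.[k%:R] != 0.
  apply: poly_nonroot; apply: contra p0 => /eqP q0.
  have hm := mlead_supp; apply/eqP/mpolyP => m; rewrite mcoeff0.
  apply/eqP; apply: contraT; rewrite -mcoeff_msupp => hm'.
  have := congr1 (fun r : {poly F} => r`_(\sum_i m i * K ^ i)) q0.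
  rewrite /q /mmap coef_sum coef0 (bigD1_seq m) ?msupp_uniq //=.
  have E m' : mmap1 (fun i : 'I_n => 'X^(K ^ i)) m' =
      'X^(\sum_i m' i * K ^ i) :> {poly F}.
    rewrite /mmap1 -prodrXr; apply: eq_bigr => i _.
    by rewrite -exprM mulnC.
  rewrite E coefCM coefXn eqxx mulr1 big_seq_cond big1 => [|m' /andP [hm'' ne]].
    by rewrite addr0 => /eqP; rewrite mcoeff_eq0 hm'.
  rewrite E coefCM coefXn; case: eqP => [e|_]; last by rewrite mulr0.
  case/eqP: ne; apply/mnmP => i.
  exact/esym/(expand_inj (mK _ hm') (mK _ hm'') e).
exists [ffun i : 'I_n => k%:R ^+ (K ^ i)]; rewrite horner_mmap in hk.
rewrite (meval_eq (v2 := fun i : 'I_n => ('X^(K ^ i)).[k%:R])) // => i.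
by rewrite ffunE hornerXn.
Qed.

(** Greedy choice: a point [z] with [ev z] nonzero at some vector of [U] makes the dimension of the
    common kernel drop. *)
Lemma unisolvent_subspace (F : fieldType) (V : vectType F) (T : eqType)
    (ev : T -> 'Hom(V, F^o)) :
    (forall v, v != 0 -> exists z, ev z v != 0) ->
  forall U : {vspace V}, exists2 s : seq T, (size s <= \dim U)%N &
    forall v, v \in U -> (forall z, z \in s -> ev z v = 0) -> v = 0.
Proof.
move=> hev U; have [k] := ubnP (\dim U); elim: k U => // k IH U.
have [U0 _|/hev [z hz]] := eqVneq (vpick U) 0.
  exists [::] => // v; move/eqP: U0; rewrite vpick0 => /eqP ->.
  by rewrite memv0 => /eqP.
rewrite ltnS => hU.
have lt_dim : (\dim (U :&: lker (ev z)) < \dim U)%N.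
  rewrite ltn_neqAle dimvS ?capvSl // andbT.
  apply: contra hz => /eqP h; have : U == (U :&: lker (ev z))%VS.
    by rewrite eq_sym eqEdim capvSl h leqnn.
  move=> /eqP hU'; have := memv_pick U.
  by rewrite {2}hU' memv_cap memv_ker => /andP [].
have [s hs h] := IH _ (leq_trans lt_dim hU).
exists (z :: s) => [|v vU hv]; first exact: leq_ltn_trans lt_dim.
apply: h => [|y ys]; last by apply: hv; rewrite inE ys orbT.
rewrite memv_cap vU memv_ker; apply/eqP/hv; exact: mem_head.
Qed.

Section Unisolvent.

Variables (F : numFieldType) (n e : nat).

Definition dhomog_eval (x : {ffun 'I_n.+1 -> F}) (p : dhomog n.+1 F e) : F^o :=
  (val p).@[x].

Lemma dhomog_eval_linear x : linear (dhomog_eval x).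
Proof. by move=> c p q; rewrite /dhomog_eval /= mevalD mevalZ. Qed.

HB.instance Definition _ x :=
  GRing.isLinear.Build F (dhomog n.+1 F e) F^o _ (dhomog_eval x) (dhomog_eval_linear x).

Lemma dim_dhomog : \dim {: dhomog n.+1 F e} = 'C(e + n, e).
Proof. exact: dimvf. Qed.

Lemma dhomog_eval_neq0 (p : dhomog n.+1 F e) : p != 0 ->
  exists x, linfun (dhomog_eval x) p != 0.
Proof.
move=> p0; have [|x hx] := @mpoly_nonroot F n.+1 (val p).
  by apply: contra p0 => /eqP h; apply/eqP/val_inj.
by exists x; rewrite lfunE.
Qed.

Lemma unisolvent_dhomog : exists2 M : seq {ffun 'I_n.+1 -> F},
    (size M <= 'C(e + n, e))%N &
    forall q : {mpoly F[n.+1]}, q \is e.-homog -> vanish_on M q -> q = 0.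
Proof.
have [M hM h] := unisolvent_subspace dhomog_eval_neq0 fullv.
exists M => [|q hq qM]; first by rewrite -dim_dhomog.
have /(congr1 val) // : DHomog hq = 0.
by apply: h => [|z /qM qz]; rewrite ?memvf // lfunE.
Qed.

(** Since [t ^+ e] is 1 at [b], vanishing at [b] cuts out a proper subspace of the forms, which
    saves one point. *)
Lemma unisolvent_dhomog_at (a b : 'I_n.+1 -> F) : (linform a).@[b] = 1 ->
  exists2 M : seq {ffun 'I_n.+1 -> F}, (size M < 'C(e + n, e))%N &
    forall q : {mpoly F[n.+1]}, q \is e.-homog -> q.@[b] = 0 ->
      vanish_on M q -> q = 0.
Proof.
move=> tb; pose evb := linfun (dhomog_eval (finfun b)).
have eb (q : {mpoly F[n.+1]}) : q.@[finfun b] = q.@[b].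
  by apply: meval_eq => i; rewrite ffunE.
have [M hM h] := unisolvent_subspace dhomog_eval_neq0 (lker evb).
exists M => [|q hq qb qM].
  apply: leq_ltn_trans hM _; rewrite -dim_dhomog ltn_neqAle dimvS ?subvf // andbT.
  apply/negP => /eqP hd.
  have /eqP hk : lker evb == fullv by rewrite eqEdim subvf hd leqnn.
  have := memvf (DHomog (dhomog_tX a e)); rewrite -hk memv_ker lfunE /=.
  by rewrite /dhomog_eval /= eb rmorphXn /= tb expr1n oner_eq0.
have /(congr1 val) // : DHomog hq = 0.
apply: h => [|z /qM qz]; last by rewrite lfunE.
by rewrite memv_ker lfunE /= /dhomog_eval /= eb qb.
Qed.

Lemma fat_point (a b : 'I_n.+1 -> F) d : (linform a).@[b] = 1 -> (e < d)%N ->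
  exists2 Z : seq {ffun 'I_n.+1 -> F}, (size Z <= 'C(e + n, e) * d)%N &
    forall p : {mpoly F[n.+1]}, p \is d.-homog -> vanish_on Z p ->
      vord (linform a) b e.+1 d p.
Proof.
move=> tb lt_ed; have [M hM h] := unisolvent_dhomog_at tb.
exists (line_points b d M) => [|p]; last exact: vord_of_points.
(* Here [size M * d + 1 <= (size M).+1 * d <= 'C(e + n, e) * d], where [0 < d] comes from
   [e < d]. *)
rewrite size_line_points (leq_trans _ (leq_mul hM (leqnn d))) // mulSn.
by rewrite -add1n leq_add2r (leq_ltn_trans _ lt_ed).
Qed.

End Unisolvent.

(** * Sums over moving points and their order in the parameter *)

Lemma rmorph_meval (A A' : comNzRingType) (f : {rmorphism A -> A'}) n
    (x : 'I_n -> A) (P : {mpoly A[n]}) :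
  f P.@[x] = (map_mpoly f P).@[f \o x].
Proof.
elim/mpolyind: P => [|c m p _ _ IH]; first by rewrite meval0 rmorph0 raddf0 meval0.
rewrite mevalD mevalZ rmorphD rmorphM /= IH rmorphD /= mevalD map_mpolyZ mevalZ.
congr (_ * _ + _); rewrite map_mpolyX !mevalX rmorph_prod.
by apply: eq_bigr => i _; rewrite rmorphXn.
Qed.

(** This lets elements of a finite type index the groups of moving points with a common limit. *)
Lemma choose_rep (T : finType) (S : eqType) (f : T -> S) :
  exists rep : T -> T, (forall x, f (rep x) = f x) /\
    forall x y, (rep x == rep y) = (f x == f y).
Proof.
pose rep x := odflt x [pick y | f y == f x].
have fr x : f (rep x) = f x.
  by rewrite /rep; case: pickP => [y /eqP|].
exists rep; split=> // x y; apply/eqP/eqP => [e|e]; first by rewrite -fr e fr.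
rewrite /rep; under eq_pick do rewrite e.
by case: pickP => [//|/(_ y)]; rewrite eqxx.
Qed.

Section Degeneration.

Variables (F : numFieldType) (n r d : nat).
Variables (Q : 'I_r -> 'I_n -> {poly F}) (w : 'I_r -> {poly F}).

(* The family [Q k] depends on the parameter ['X]; [at0] is the limit at [0]. *)
Definition wsum (B : {pred 'I_r}) (P : {mpoly {poly F}[n]}) : {poly F} :=
  \sum_(k in B) w k * P.@[Q k].

Definition wsum_dvd v B :=
  forall P : {mpoly {poly F}[n]}, P \is d.-homog -> 'X^v %| wsum B P.

Local Notation lift := (map_mpoly polyC).
Local Notation at0 := (map_mpoly (horner_eval 0)).

Lemma wsumD B P P' : wsum B (P + P') = wsum B P + wsum B P'.
Proof. by rewrite -big_split; apply: eq_bigr => k _; rewrite mevalD mulrDr. Qed.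

Lemma wsumZ B c P : wsum B (c *: P) = c * wsum B P.
Proof. by rewrite mulr_sumr; apply: eq_bigr => k _; rewrite mevalZ mulrCA. Qed.

Lemma at0_lift p : at0 (lift p) = p :> {mpoly F[n]}.
Proof.
by apply/mpolyP => m; rewrite !mcoeff_map_mpoly /= /horner_eval hornerC.
Qed.

Lemma dhomog_map (A A' : comNzRingType) (f : {rmorphism A -> A'}) e (P : {mpoly A[n]}) :
  P \is e.-homog -> map_mpoly f P \is e.-homog.
Proof.
move=> /dhomogP hP; apply/dhomogP => m; rewrite mcoeff_msupp mcoeff_map_mpoly.
by move=> h; apply: hP; rewrite mcoeff_msupp; apply: contra h => /eqP ->; rewrite raddf0.
Qed.

(** Every coefficient of [P] is divisible by ['X], which adds one factor to the ['X^v] contributed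
    by each monomial. *)
Lemma wsum_dvdS v B P : wsum_dvd v B -> P \is d.-homog -> at0 P = 0 ->
  'X^(v.+1) %| wsum B P.
Proof.
move=> hv /dhomogP hP P0; rewrite (mpolyE P) big_seq.
elim/big_ind: _ => [|p q hp hq|m hm].
- by rewrite /wsum big1 ?dvdp0 // => k _; rewrite meval0 mulr0.
- by rewrite wsumD dvdp_add.
rewrite wsumZ exprS dvdp_mul //; last by apply: hv; rewrite dhomogX hP.
rewrite -['X]subr0 -polyC0 dvdp_XsubCl rootE -/(horner_eval 0 _).
by rewrite -mcoeff_map_mpoly P0 mcoeff0.
Qed.

(** The coefficient of ['X^v] in the sum depends only on the limit of the form, so any convenient
    lift may be used. *)
Lemma wsum_dvdS_eq v B P P' : wsum_dvd v B -> P \is d.-homog -> P' \is d.-homog ->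
  at0 P = at0 P' -> 'X^(v.+1) %| wsum B P' -> 'X^(v.+1) %| wsum B P.
Proof.
move=> hv hP hP' e h; rewrite -[P](subrK P') wsumD dvdp_add //.
by apply: wsum_dvdS => //; [exact: rpredB | rewrite rmorphB /= e subrr].
Qed.

Lemma wsum_dvdW v B : (forall m, mdeg m = d -> 'X^v %| wsum B 'X_[m]) -> wsum_dvd v B.
Proof.
move=> h; apply: dhomog_ind => [|p q hp hq|c m hm].
- by rewrite /wsum big1 ?dvdp0 // => k _; rewrite meval0 mulr0.
- by rewrite wsumD dvdp_add.
by rewrite wsumZ dvdp_mull // h.
Qed.

Variable a : 'I_n -> F.
Local Notation t := (linform a).
Local Notation pt k := [ffun i => (Q k i).[0]].
Hypothesis tQ : forall k, t.@[pt k] = 1.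

(* A lift of [X_i - b_i t], where [b] is the limit of [Q k], vanishing at [Q k]. *)
Let Yk k i : {mpoly {poly F}[n]} :=
  (lift t).@[Q k] *: 'X_i - Q k i *: lift t.

Let dhomog_lift_t : lift t \is 1.-homog.
Proof. exact/dhomog_map/dhomog_linform. Qed.

Let dhomog_Yk k i : Yk k i \is 1.-homog.
Proof. by apply: rpredB; apply: dhomogZ; rewrite ?dhomogU. Qed.

Let Yk_Q k i : (Yk k i).@[Q k] = 0.
Proof. by rewrite mevalB !mevalZ mevalXU mulrC subrr. Qed.

Let at0_eval k (P : {mpoly {poly F}[n]}) : (P.@[Q k]).[0] = (at0 P).@[pt k].
Proof.
rewrite -/(horner_eval 0 _) rmorph_meval.
by apply: meval_eq => i; rewrite ffunE.
Qed.

Let at0_Yk k i : at0 (Yk k i) = 'X_i - (pt k i) *: t.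
Proof.
rewrite rmorphB /= !map_mpolyZ map_mpolyX at0_lift; congr (_ - _ *: _).
  by rewrite /= /horner_eval at0_eval at0_lift tQ scale1r.
by rewrite ffunE.
Qed.

(** Each of the [size s] generators in a product is lifted by a [Yk k i] for a different [k] in [s],
    so the lifted product vanishes at all these points. *)
Lemma lift_vord (b : 'I_n -> F) (s : seq 'I_r) e p :
    (forall k, k \in s -> pt k =1 b) -> vord t b (size s) e p ->
  exists P, [/\ P \is e.-homog, at0 P = p & forall k, k \in s -> P.@[Q k] = 0].
Proof.
elim: s e p => [|k s IH] e p hs /=.
  by move=> hp; exists (lift p); rewrite at0_lift dhomog_map.
case: e => [|e].
  move=> ->; exists 0; rewrite dhomog0 rmorph0; split=> // k' _.
  exact: meval0.
case=> g hg ->.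
have IHs i : exists P, [/\ P \is e.-homog, at0 P = g i
    & forall k, k \in s -> P.@[Q k] = 0].
  by apply: IH (hg i) => k' hk'; apply: hs; rewrite inE hk' orbT.
have /fin_all_exists [G hG] := IHs.
exists (\sum_i Yk k i * G i); split.
- apply: dhomog_sum => i _; rewrite -add1n; apply: dhomogM => //.
  by case: (hG i).
- rewrite rmorph_sum; apply: eq_bigr => i _; rewrite rmorphM /= at0_Yk.
  by rewrite hs ?mem_head //; case: (hG i) => _ ->.
move=> k'; rewrite inE rmorph_sum /= => h; rewrite big1 // => i _.
rewrite rmorphM /=; case/orP: h => [/eqP ->|h]; first by rewrite Yk_Q mul0r.
by case: (hG i) => _ _ ->; rewrite // mulr0.
Qed.

(** [U] is a product of forms [Yk k i], one per [k], with [i] a coordinate where the limit of [Q k]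
    differs from [b]; as [t] is 1 at both, this factor is nonzero at [b] in the limit. *)
Lemma lift_separating (b : {ffun 'I_n -> F}) (s : seq 'I_r) : t.@[b] = 1 ->
    (forall k, k \in s -> pt k != b) ->
  exists U, [/\ U \is (size s).-homog, (at0 U).@[b] != 0
              & forall k, k \in s -> U.@[Q k] = 0].
Proof.
move=> tb; elim: s => [|k s IH] hs.
  by exists 1; rewrite dhomog1 rmorph1 meval1 oner_eq0.
have [|U [hU Ub Us]] := IH; first by move=> k' h; apply: hs; rewrite inE h orbT.
have [i hi] : exists i, pt k i != b i.
  apply/existsP; apply: contraR (hs k (mem_head _ _)).
  rewrite negb_exists => /forallP h; apply/eqP/ffunP => i; apply/eqP.
  by rewrite -[_ == _]negbK.
exists (Yk k i * U); split.
- by rewrite /= -add1n; apply: dhomogM.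
- have -> : at0 (Yk k i * U) = at0 (Yk k i) * at0 U by exact: rmorphM.
  rewrite mevalM mulf_neq0 // at0_Yk mevalB mevalZ mevalXU tb mulr1.
  by rewrite subr_eq0 eq_sym.
move=> k'; rewrite inE rmorphM /= => /orP [/eqP ->|h]; first by rewrite Yk_Q mul0r.
by rewrite Us // mulr0.
Qed.

(* Induction on the exponent: if [eps^v] divides all class sums with [v < N], their
   coefficients of [eps^v] define a functional that kills the [#|B|]-th power of
   the ideal of the limit point and the multiples of a form [U] killing the other
   classes; the two together span all forms of degree [d] since [r <= d + 1]. *)
Lemma wsum_dvd_class N (k0 : 'I_r) : wsum_dvd N predT -> (r <= d.+1)%N ->
  wsum_dvd N [pred k | pt k == pt k0].
Proof.
set B := [pred k | _] => hN le_rd.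
suff: forall v, (v <= N)%N -> wsum_dvd v B by apply.
elim=> [|v IH] lt_vN; first by move=> P _; rewrite expr0 dvd1p.
have {}IH := IH (ltnW lt_vN).
have B_s k : (k \in enum B) = (pt k == pt k0) by rewrite mem_enum.
have Bc_s k : (k \in enum [predC B]) = (pt k != pt k0) by rewrite mem_enum.
have cardB : (#|B| + #|[predC B]| = r)%N by rewrite cardC card_ord.
have [|U [hU Ub Us]] := @lift_separating (pt k0) (enum [predC B]) (tQ k0).
  by move=> k; rewrite Bc_s.
rewrite -cardE in hU.
(* [i] is the defect in vanishing order: [i = 0] gives the [#|B|]-th power of the ideal, [i = #|B|]
   gives all forms. *)
suff main i p : (i <= #|B|)%N -> vord t (pt k0) (#|B| - i) d p ->
    'X^(v.+1) %| wsum B (lift p).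
  move=> P hP; apply: (wsum_dvdS_eq IH hP (P' := lift (at0 P))).
  - exact/dhomog_map/dhomog_map.
  - by rewrite at0_lift.
  by apply: (main #|B|) => //; rewrite subnn; apply: dhomog_map.
elim: i p => [|i IHi] p.
  rewrite subn0 cardE => _ hp.
  have [k|P [hP Pp Ps]] := lift_vord _ hp.
    by rewrite B_s => /eqP h i; rewrite h.
  apply: (wsum_dvdS_eq IH _ hP); rewrite ?at0_lift //.
    exact/dhomog_map/(vord_homog hp).
  by rewrite /wsum big1 ?dvdp0 // => k hk; rewrite Ps ?mulr0 // mem_enum.
move=> lt_i hp.
(* The degree condition of the division, [(#|B| - i.+1) + #|[predC B]| <= d], follows from
   [r <= d.+1]. *)
have [|q hq hpq] := vord_divide (tQ k0) (dhomog_map _ hU) Ub hp.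
  rewrite -ltnS; apply: leq_trans le_rd; rewrite -[leqRHS]cardB.
  by rewrite -addSn leq_add2r subnSK // leq_subr.
rewrite (subnSK lt_i) in hpq.
have le_d : (#|[predC B]| <= d)%N.
  rewrite -ltnS; apply: leq_trans le_rd; rewrite -[leqRHS]cardB.
  rewrite -addn1 addnC leq_add2r.
  exact: leq_ltn_trans lt_i.
have hUq : U * lift q \is d.-homog.
  by rewrite -(subnKC le_d); apply: dhomogM => //; apply: dhomog_map.
rewrite -[p](subrK (at0 U * q)) rmorphD wsumD.
apply: dvdp_add; first by apply: IHi (ltnW lt_i) hpq.
apply: (wsum_dvdS_eq IH _ hUq).
- by apply: dhomog_map; rewrite -(subnKC le_d); apply: dhomogM => //; apply: dhomog_map.
- by rewrite at0_lift rmorphM /= at0_lift.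
apply: dvdp_trans (dvdp_exp2l _ lt_vN) _.
(* [U] vanishes at the [Q k] outside the class, so the class sum is the full sum, to which [hN]
   applies. *)
have -> : wsum B (U * lift q) = wsum predT (U * lift q).
  rewrite /wsum big_mkcond; apply: eq_bigr => k _.
  case: ifPn => // hk; rewrite rmorphM /= Us ?mul0r ?mulr0 //.
  by rewrite mem_enum.
exact: hN.
Qed.

(** For each class, some lift of [p] vanishes at all its moving points; as the class sum is
    divisible by ['X^N], changing the lift costs only a multiple of ['X^(N.+1)]. *)
Lemma wsum_dvd_fat N p : wsum_dvd N predT -> (r <= d.+1)%N ->
    (forall k0, vord t (pt k0) #|[pred k | pt k == pt k0]| d p) ->
  'X^(N.+1) %| wsum predT (lift p).
Proof.
move=> hN le_rd hp.
have [rep [_ rep_eq]] := choose_rep (fun k => pt k).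
rewrite /wsum (partition_big rep predT) //=.
elim/big_ind: _ => [|x y|j _]; [exact: dvdp0|exact: dvdp_add|].
have [[k0 /eqP <-]|nj] := altP (@existsP _ (fun k => rep k == j)); last first.
  rewrite big_pred0 ?dvdp0 // => k; apply/negbTE; apply: contra nj => h.
  by apply/existsP; exists k.
rewrite (eq_bigl (mem [pred k | pt k == pt k0])) => [|k]; last by rewrite rep_eq.
have hB := wsum_dvd_class k0 hN le_rd.
have hp0 := hp k0; rewrite cardE in hp0.
have [k|P [hP Pp Ps]] := lift_vord _ hp0.
  by rewrite mem_enum => /eqP h i; rewrite h.
apply: (wsum_dvdS_eq hB _ hP); rewrite ?at0_lift //.
  exact/dhomog_map/(vord_homog hp0).
by rewrite /wsum big1 ?dvdp0 // => k hk; rewrite Ps ?mulr0 // mem_enum.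
Qed.

End Degeneration.

(* In [s + 1] variables, the number of monomials of degree [c - 1]. *)
Definition fat_dim s c := if c is c'.+1 then 'C(c' + s, c') else 0%N.

(** * Superadditivity of the bound, and kernels over polynomials *)

Lemma leq_fat_dim s s' c : (s <= s')%N -> (fat_dim s c <= fat_dim s' c)%N.
Proof. by case: c => //= c le_s; apply: leq_bin2l; rewrite leq_add2l. Qed.

(** By Pascal's rule the increments of [fat_dim s] are binomials that grow with the argument. For
    [s = 0] the function is constantly 1 on positive arguments and superadditivity fails. *)
Lemma fat_dimD s a c : (0 < s)%N -> (fat_dim s a + fat_dim s c <= fat_dim s (a + c))%N.
Proof.
case: s => // s _; case: a c => [|a] [|c] //; first by rewrite !addn0.
have E k : fat_dim s.+1 k.+1 = 'C(k + s.+1, s.+1).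
  by rewrite /= -[in RHS](@bin_sub (k + s.+1)) ?leq_addl // addnK.
have mono k l : (k <= l)%N -> ('C(k + s.+1, s) <= 'C(l + s.+1, s))%N.
  by move=> h; apply: leq_bin2l; rewrite leq_add2r.
have rec k : 'C(k.+1 + s.+1, s.+1) = ('C(k + s.+1, s.+1) + 'C(k + s.+1, s))%N.
  by rewrite addSn binS.
rewrite [(a.+1 + _)%N]addSn [(a + c.+1)%N]addnS !E; elim: c => [|c IH].
  rewrite addn0 rec leq_add2l add0n binn bin_gt0.
  by rewrite addnS (leq_trans (leqnSn s)) // ltnS leq_addl.
rewrite rec [(a + c.+1)%N]addnS rec addnA leq_add // mono //.
by rewrite (leq_trans (leq_addl a c)).
Qed.

Lemma fat_dim_diag r : (0 < r)%N -> fat_dim r.-1 r = 'C(2 * r - 2, r - 1).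
Proof. by case: r => //= r _; congr 'C(_, _); lia. Qed.

Lemma sum_fat_dim s (I : finType) (P : pred I) (c : I -> nat) : (0 < s)%N ->
  (\sum_(i | P i) fat_dim s (c i) <= fat_dim s (\sum_(i | P i) c i))%N.
Proof.
move=> s0; elim/big_ind2: _ => // x1 y1 x2 y2 h1 h2.
exact: leq_trans (leq_add h1 h2) (fat_dimD _ _ s0).
Qed.

(* [c = 0] when [Q] is identically zero. *)
Lemma primitive_vector (F : fieldType) n (Q : 'I_n.+1 -> {poly F}) :
  exists c (Q' : 'I_n.+1 -> {poly F}), (exists i, (Q' i).[0] != 0) /\
    forall i, Q i = c * Q' i.
Proof.
have [/forallP Q0|] := boolP [forall i, Q i == 0].
  exists 0, (fun=> 1); split; first by exists ord0; rewrite hornerC oner_eq0.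
  by move=> i; rewrite mul0r; apply/eqP.
rewrite negb_forall => /existsP [i0].
have [s] := ubnP (size (Q i0)); elim: s Q => // s IH Q; rewrite ltnS => hs Qi0.
have [/existsP h|] := boolP [exists i, (Q i).[0] != 0].
  by exists 1, Q; split=> // i; rewrite mul1r.
rewrite negb_exists => /forallP h.
have /fin_all_exists [G hG] i : exists q, Q i = q * 'X.
  have /factor_theorem [q ->] : root (Q i) 0.
    by rewrite rootE; move: (h i); rewrite negbK.
  by exists q; rewrite polyC0 subr0.
have G0 : G i0 != 0 by apply: contra Qi0 => /eqP g0; rewrite hG g0 mul0r.
have [|//|c [Q' [hQ' e]]] := IH G.
  by rewrite (leq_trans _ hs) // hG size_mulX.
exists (c * 'X), Q'; split=> // i; rewrite hG e; ring.
Qed.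

(** Fraction-free elimination: the first row is made primitive, so its pivot [b i0] is nonzero at 0
    and the solution, scaled by the pivot, stays nonzero at 0. *)
Lemma kernel_vector (F : fieldType) r n (A : 'I_r -> 'I_n -> {poly F}) : (r < n)%N ->
  exists l : 'I_n -> {poly F}, (exists i, (l i).[0] != 0) /\
    forall k, \sum_i A k i * l i = 0.
Proof.
elim: r n A => [|r IH] [|n] A // lt_rn.
  exists (fun=> 1); split; last by case.
  by exists ord0; rewrite hornerC oner_eq0.
have [c [b [[i0 hi0] hb]]] := primitive_vector (A ord0).
pose A' k j := A (lift ord0 k) (lift i0 j) * b i0 - A (lift ord0 k) i0 * b (lift i0 j).
have [//|m [[j hj] hm]] := IH n A'.
pose l i := if unlift i0 i is Some j then b i0 * m j
            else - \sum_j b (lift i0 j) * m j.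
have l0 : l i0 = - \sum_j b (lift i0 j) * m j by rewrite /l unlift_none.
have lS k : l (lift i0 k) = b i0 * m k by rewrite /l liftK.
exists l; split; first by exists (lift i0 j); rewrite lS hornerM mulf_neq0.
move=> k; rewrite (bigD1_ord i0) //= l0; under eq_bigr do rewrite lS.
case: (unliftP ord0 k) => [k'|] ->.
  rewrite -[RHS](hm k') mulrN mulr_sumr -sumrN -big_split; apply: eq_bigr => i _ /=.
  rewrite /A'; ring.
rewrite !hb mulrN mulr_sumr -sumrN -big_split big1 // => i _ /=.
rewrite !hb; ring.
Qed.

Lemma map_mpoly_comp_mpoly (A A' : comNzRingType) (f : {rmorphism A -> A'}) n k
    (g : 'I_n -> {mpoly A[k]}) (P : {mpoly A[n]}) :
  map_mpoly f (P \mPo [tuple g i | i < n]) =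
  map_mpoly f P \mPo [tuple map_mpoly f (g i) | i < n].
Proof.
elim/mpolyind: P => [|c m p _ _ IH]; first by rewrite !(comp_mpoly0, raddf0).
rewrite comp_mpolyD comp_mpolyZ !rmorphD /= !map_mpolyZ IH comp_mpolyZ.
congr (_ *: _ + _); rewrite map_mpolyX !comp_mpolyX rmorph_prod.
by apply: eq_bigr => i _; rewrite rmorphXn /= !tnth_mktuple.
Qed.

(** * Point sets attached to moving points *)

Section BorderPoints.

Variable F : numFieldType.
Local Notation lift_mp := (map_mpoly polyC).
Local Notation at0 := (map_mpoly (horner_eval 0)).
Local Notation one := (fun=> 1).

(* The [Q k] are first rescaled so that their limits lie on the affine hyperplane
   where one generic linear form equals [1]; then distinct limits are distinct
   projective points. *)
Lemma border_points_essential r n N d (Q : 'I_r -> 'I_n.+1 -> {poly F}) :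
    (n.+1 <= r <= d)%N -> (1 < r)%N -> wsum_dvd d Q one N predT ->
  exists2 Z : seq {ffun 'I_n.+1 -> F}, (size Z <= 'C(2 * r - 2, r - 1) * d)%N &
    forall p : {mpoly F[n.+1]}, p \is d.-homog -> vanish_on Z p ->
      'X^(N.+1) %| wsum Q one predT (lift_mp p).
Proof.
move=> /andP [le_nr le_rd] r1 hN.
have /fin_all_exists [c hc] k := primitive_vector (Q k).
have {hc} /fin_all_exists [Q1 hQ1] := hc.
have {hQ1} [Q10 QE] := all_and2 hQ1.
(* [a] is a generic linear form, nonzero at the limit of every primitive [Q1 k]. *)
have [a ha] : exists a : {ffun 'I_n.+1 -> F},
    (\prod_k linform (fun i => (Q1 k i).[0])).@[a] != 0.
  apply: mpoly_nonroot; apply/prodf_neq0 => k _; have [i hi] := Q10 k.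
  apply: contra hi => /eqP /(congr1 (mcoeff U_(i)%MM)) h; apply/eqP.
  by move: h; rewrite mcoeff_linform mcoeff0.
pose tau k := \sum_i (Q1 k i).[0] * a i.
have tau0 k : tau k != 0.
  move: ha; rewrite rmorph_prod /= => /prodf_neq0 /(_ k isT).
  by rewrite meval_linform.
pose Q2 k i := (tau k)^-1 *: Q1 k i.
(* By homogeneity, the scalars relating [Q k] to the normalised [Q2 k] become weights. *)
pose w k := (c k * (tau k)%:P) ^+ d.
have QE2 k i : Q k i = c k * (tau k)%:P * Q2 k i.
  by rewrite QE -mulrA /Q2 -mul_polyC [_%:P * (_ * _)]mulrA -polyCM divff // mul1r.
pose b k : {ffun 'I_n.+1 -> F} := [ffun i => (Q2 k i).[0]].
have tb k : (linform a).@[b k] = 1.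
  rewrite meval_linform -[RHS](mulVf (tau0 k)) mulr_sumr; apply: eq_bigr => i _.
  by rewrite ffunE hornerZ mulrCA [a i * _]mulrC.
have sumE (P : {mpoly {poly F}[n.+1]}) : P \is d.-homog ->
    wsum Q one predT P = wsum Q2 w predT P.
  move=> hP; apply: eq_bigr => k _; rewrite mul1r -(meval_dhomogZ _ _ hP).
  by apply: meval_eq.
have hN2 : wsum_dvd d Q2 w N predT by move=> P hP; rewrite -sumE //; apply: hN.
pose m k := #|[pred k' | b k' == b k]|.
have m0 k : (0 < m k)%N by apply/card_gt0P; exists k; rewrite inE.
have le_mr k : (m k <= r)%N by rewrite -[leqRHS]card_ord max_card.
have /fin_all_exists2 [Z sZ hZ] k :
    exists2 Z : seq {ffun 'I_n.+1 -> F}, (size Z <= fat_dim n (m k) * d)%N &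
    forall p : {mpoly F[n.+1]}, p \is d.-homog -> vanish_on Z p ->
      vord (linform a) (b k) (m k) d p.
  move: (m0 k) (leq_trans (le_mr k) le_rd); case: (m k) => // e _.
  exact: fat_point.
have [rep [b_rep rep_eq]] := choose_rep b.
exists (flatten [seq Z k | k <- enum [pred k | rep k == k]]) => [|p hp pZ].
  rewrite size_flatten /shape -map_comp sumnE big_map big_enum /=.
  apply: (@leq_trans (\sum_(k | rep k == k) fat_dim r.-1 (m k) * d)).
    apply: leq_sum => k _; apply: leq_trans (sZ k) _; rewrite leq_mul2r.
    by rewrite leq_fat_dim ?orbT //; lia.
  rewrite -big_distrl leq_mul2r /=; apply/orP; right.
  apply: leq_trans (sum_fat_dim _ _ _) _; first by lia.
  (* The classes of equal limits partition ['I_r]. *)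
  have -> : (\sum_(k | rep k == k) m k = r)%N.
    rewrite -[RHS]card_ord -sum1_card [RHS](partition_big rep (fun k => rep k == k)) /=.
      apply: eq_bigr => k /eqP rk; rewrite /m -sum1_card; apply: eq_bigl => k'.
      by rewrite inE -rep_eq rk.
    by move=> k _; rewrite rep_eq b_rep.
  by rewrite fat_dim_diag // (ltnW r1).
rewrite sumE; last exact: dhomog_map.
apply: (wsum_dvd_fat tb hN2 (leqW le_rd)) => // k.
have -> : #|[pred k' | b k' == b k]| = m (rep k).
  by apply: eq_card => k'; rewrite !inE b_rep.
rewrite -/(b k) -b_rep; apply: hZ => // z zZ; apply: pZ.
apply/flattenP; exists (Z (rep k)) => //; apply: map_f.
by rewrite mem_enum inE rep_eq b_rep.
Qed.

End BorderPoints.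

Section BorderPointsGeneral.

Variable F : numFieldType.
Local Notation lift_mp := (map_mpoly polyC).
Local Notation at0 := (map_mpoly (horner_eval 0)).
Local Notation one := (fun=> 1).

Lemma border_points r n N d (Q : 'I_r -> 'I_n -> {poly F}) :
    (0 < d)%N -> wsum_dvd d Q one N predT ->
  exists2 Z : seq {ffun 'I_n -> F}, (size Z <= 'C(2 * r - 2, r - 1) * d)%N &
    forall p : {mpoly F[n]}, p \is d.-homog -> vanish_on Z p ->
      'X^(N.+1) %| wsum Q one predT (lift_mp p).
Proof.
move=> d0; elim: n Q => [|n IH] Q hN.
  exists [::] => // p hp _.
  suff -> : p = 0 by rewrite raddf0 /wsum big1 ?dvdp0 // => k _; rewrite meval0 mulr0.
  apply/mpolyP => m; rewrite mcoeff0 (dhomog_nemf_coeff hp) //.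
  by rewrite /= mdegE big_ord0 eq_sym -lt0n.
have [le_nr|lt_rn] := leqP n.+1 r.
  have r0 : (0 < r)%N by apply: leq_trans le_nr.
  have [/andP [le_rd r1]|small] := boolP ((r <= d) && (1 < r))%N.
    by apply: border_points_essential => //; rewrite le_nr.
  (* In the case [d < r] or [r <= 1], a set unisolvent for all forms is small enough. *)
  have [M hM hZ] := unisolvent_dhomog F n d.
  exists M => [|p hp pM]; last first.
    rewrite (hZ p) // raddf0 /wsum big1 ?dvdp0 // => k _.
    by rewrite meval0 mulr0.
  apply: leq_trans hM _; rewrite -[leqLHS]muln1 leq_mul //.
  move: small; rewrite negb_and -ltnNge -leqNgt => /orP [lt_dr|le_r1]; last first.
    have -> : n = 0%N by lia.
    by rewrite addn0 binn bin_gt0; lia.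
  (* Both [n] and [d] are at most [r - 1] here. *)
  apply: (@leq_trans 'C(d + r.-1, d)); first by apply: leq_bin2l; lia.
  rewrite -bin_sub ?leq_addr // addKn.
  have -> : (r - 1 = r.-1)%N by lia.
  by apply: leq_bin2l; lia.
(* With more variables than points, [l] is a linear form over [{poly F}] vanishing at every [Q k];
   it eliminates the variable [i0]. *)
have [l [[i0 li0] hl]] := kernel_vector Q lt_rn.
pose Q' k j := Q k (lift i0 j).
have wsum_drop (P : {mpoly {poly F}[n]}) :
    wsum Q' one predT P =
    wsum Q one predT (P \mPo [tuple 'X_(lift i0 j) | j < n]).
  apply: eq_bigr => k _; rewrite comp_mpoly_meval; congr (_ * _).
  by apply: meval_eq => j; rewrite tnth_mktuple mevalXU.
have hN' : wsum_dvd d Q' one N predT.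
  move=> P hP; rewrite wsum_drop; apply/hN/dhomog_comp => // j.
  exact: dhomogU.
have [Z sZ hZ] := IH Q' hN'.
(* [s] parametrises the hyperplane where [linform u] vanishes, [t0] projects onto it along the
   coordinate [i0], and [te] deforms [t0] so as to fix each [Q k]. *)
pose u i := (l i).[0].
pose s i : {mpoly F[n]} := if unlift i0 i is Some j then 'X_j
  else - linform (fun j => u (lift i0 j) / u i0).
pose t0 i : {mpoly F[n.+1]} := if i == i0 then 'X_i0 - (u i0)^-1 *: linform u else 'X_i.
pose te i : {mpoly {poly F}[n.+1]} :=
  if i == i0 then 'X_i0 - ((u i0)^-1)%:P *: linform l else 'X_i.
have hs i : s i \is 1.-homog.
  by rewrite /s; case: unliftP => [j|] _; rewrite ?dhomogU // rpredN dhomog_linform.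
have ht0 i : t0 i \is 1.-homog.
  by rewrite /t0; case: eqP; rewrite ?dhomogU // rpredB ?dhomogU ?dhomogZ ?dhomog_linform.
have hte i : te i \is 1.-homog.
  by rewrite /te; case: eqP; rewrite ?dhomogU // rpredB ?dhomogU ?dhomogZ ?dhomog_linform.
have map_linform (A A' : comNzRingType) (f : {rmorphism A -> A'}) m (a : 'I_m -> A) :
    map_mpoly f (linform a) = linform (f \o a).
  rewrite /linform rmorph_sum; apply: eq_bigr => i _.
  by rewrite /= map_mpolyZ map_mpolyX.
have at0_te i : at0 (te i) = t0 i.
  rewrite /te /t0; case: eqP => _; last by rewrite map_mpolyX.
  rewrite rmorphB /= map_mpolyX map_mpolyZ /= map_linform.
  by rewrite /horner_eval hornerC.
exists [seq [ffun i => (s i).@[z]] | z : {ffun _ -> _} <- Z] => [|p hp pZ].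
  by rewrite size_map.
have hs_p : p \mPo [tuple s i | i < n.+1] \is d.-homog by apply: dhomog_comp.
have e1 : wsum Q one predT (lift_mp p) =
    wsum Q one predT (lift_mp p \mPo [tuple te i | i < n.+1]).
  apply: eq_bigr => k _; rewrite comp_mpoly_meval; congr (_ * _).
  apply: meval_eq => i; rewrite tnth_mktuple /te; case: eqP => [->|_].
    rewrite mevalB mevalZ meval_linform mevalXU.
    by under eq_bigr do rewrite mulrC; rewrite hl mulr0 subr0.
  by rewrite mevalXU.
have cancel (q q' : {poly F}) :
    q - ((u i0)^-1)%:P * ((u i0)%:P * q + q') = - (((u i0)^-1)%:P * q').
  rewrite mulrDr mulrA -polyCM (mulVf (li0 : u i0 != 0)).
  by rewrite mul1r opprD addrA subrr sub0r.
have e2 : wsum Q' one predT (lift_mp (p \mPo [tuple s i | i < n.+1])) =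
    wsum Q one predT (lift_mp (p \mPo [tuple t0 i | i < n.+1])).
  apply: eq_bigr => k _; rewrite !map_mpoly_comp_mpoly !comp_mpoly_meval.
  congr (_ * _); apply: meval_eq => i; rewrite !tnth_mktuple /s /t0.
  case: unliftP => [j|] ->.
    by rewrite eq_sym (negbTE (neq_lift _ _)) !map_mpolyX !mevalXU.
  have -> : lift_mp (- linform (fun j => u (lift i0 j) / u i0)) =
      - linform (fun j => (u (lift i0 j) / u i0)%:P).
    by rewrite rmorphN; congr (- _); rewrite /= map_linform.
  have -> : lift_mp (if i0 == i0 then 'X_i0 - (u i0)^-1 *: linform u else 'X_i0) =
      'X_i0 - ((u i0)^-1)%:P *: linform (fun i => (u i)%:P).
    rewrite eqxx.
    transitivity (lift_mp 'X_i0 - lift_mp ((u i0)^-1 *: linform u)).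
      exact: raddfB.
    by rewrite map_mpolyX map_mpolyZ map_linform.
  rewrite [LHS]mevalN [RHS]mevalB [X in _ = _ - X]mevalZ [X in _ = X - _]mevalXU.
  rewrite [X in - X = _]meval_linform [X in _ = _ - _ * X]meval_linform.
  have -> : \sum_i (u i)%:P * Q k i =
      (u i0)%:P * Q k i0 + \sum_j (u (lift i0 j))%:P * Q k (lift i0 j).
    exact: (bigD1_ord i0).
  rewrite cancel mulr_sumr; congr (- _); apply: eq_bigr => j _.
  by rewrite [_ / _]mulrC polyCM mulrA.
rewrite e1; apply: (wsum_dvdS_eq hN (P' := lift_mp (p \mPo [tuple t0 i | i < n.+1]))).
- exact: dhomog_comp hte (dhomog_map _ hp).
- exact: dhomog_map (dhomog_comp ht0 hp).
- rewrite at0_lift map_mpoly_comp_mpoly at0_lift; congr (_ \mPo _).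
  by apply: eq_from_tnth => i; rewrite !tnth_mktuple at0_te.
rewrite -e2; apply: (hZ _ hs_p) => z zZ; rewrite comp_mpoly_meval.
rewrite -[RHS](pZ [ffun i => (s i).@[z]]).
  by apply: meval_eq => i; rewrite tnth_mktuple ffunE.
exact: (map_f (fun z : {ffun _ -> _} => [ffun i => (s i).@[z]])).
Qed.

End BorderPointsGeneral.

(** * Duality and the Waring decomposition *)

(** [c m] is a multinomial coefficient, the same for all rings since it serves over both [F] and
    [{poly F}]. *)
Lemma linform_exp_coef n d : exists c : 'X_{1..n} -> nat,
  (forall m, mdeg m = d -> 0 < c m)%N /\
  forall (A : comNzRingType) (a : 'I_n -> A) m, mdeg m = d ->
    (linform a ^+ d)@_m = (c m)%:R * ('X_[m]).@[a].
Proof.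
elim: d => [|d [c [c0 hc]]].
  exists (fun=> 1%N); split=> // A a m /eqP; rewrite mdeg_eq0 => /eqP ->.
  by rewrite expr0 mcoeff1 eqxx mpolyX0 meval1 mulr1.
exists (fun m : 'X_{1..n} => \sum_(i | 0 < m i) c (m - U_(i))%MM)%N.
split=> [m hm|A a m hm].
  have [i hi] := mdegS_neq0 hm.
  by rewrite (bigD1 i) //= ltn_addr // c0 //; case: (mdegS_subU hm hi).
rewrite exprS {1}/linform mulr_suml raddf_sum natr_sum mulr_suml [RHS]big_mkcond.
apply: eq_bigr => i _; rewrite /= -scalerAl mcoeffZ mulrC ['X_i * _]mulrC.
case: ifPn => [hi|]; last first.
  rewrite -eqn0Ngt => /eqP mi0; rewrite memN_msupp_eq0 ?mul0r //.
  rewrite (perm_mem (msuppMX _ _)); apply/mapP => -[m' _ em].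
  by move: mi0; rewrite em mnmDE mnm1E eqxx.
have [em hm'] := mdegS_subU hm hi.
have -> : ('X_[m]).@[a] = a i * ('X_[m - U_(i)]).@[a].
  by rewrite {1}em mpolyXD mevalM mevalXU.
by rewrite {1}em mcoeffMX hc // mulrCA mulrC mulrA.
Qed.

(** A functional vanishing on the common kernel of finitely many evaluations is a combination of
    them; in coordinates, the row [v] lies in the row space of [B]. *)
Lemma dual_span (F : fieldType) n d (Z : seq {ffun 'I_n -> F}) (L : {mpoly F[n]} -> F) :
    (forall c p q, L (c *: p + q) = c * L p + L q) ->
    (forall p, p \is d.-homog -> vanish_on Z p -> L p = 0) ->
  exists l : 'I_(size Z) -> F, forall m, mdeg m = d ->
    L 'X_[m] = \sum_j l j * ('X_[m]).@[tnth (in_tuple Z) j].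
Proof.
move=> linL hL.
have L0 : L 0 = 0 by have := linL (-1) 0 0; rewrite scaler0 addr0 mulN1r addNr.
have LE (I : finType) (c : I -> F) (p : I -> {mpoly F[n]}) :
    L (\sum_i c i *: p i) = \sum_i c i * L (p i).
  elim: (index_enum I) => [|i s IH]; first by rewrite !big_nil.
  by rewrite !big_cons linL IH.
pose M := #|{: 'X_{1..n < d.+1}}|.
pose e (i : 'I_M) : 'X_{1..n} := val (enum_val i).
(* The index type also contains monomials of degree below [d], replaced here by 0. *)
pose X i : {mpoly F[n]} := if mdeg (e i) == d then 'X_[e i] else 0.
have hX i : X i \is d.-homog by rewrite /X; case: ifP; rewrite ?dhomog0 ?dhomogX.
pose B := \matrix_(j < size Z, i < M) (X i).@[tnth (in_tuple Z) j].
pose v := \row_(i < M) L (X i).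
have /submxP [l hl] : (v <= B)%MS.
  rewrite submxE; apply/eqP/rowP => k; rewrite !mxE.
  pose p := \sum_i (cokermx B) i k *: X i.
  transitivity (L p); first by rewrite LE; apply: eq_bigr => i _; rewrite mxE mulrC.
  apply: hL => [|z /(nthP z) [j ltj <-]].
    by apply: dhomog_sum => i _; apply: dhomogZ.
  have := congr1 (fun A : 'M_(_, _) => A (Ordinal ltj) k) (mulmx_coker B).
  rewrite !mxE => <-; rewrite /p rmorph_sum; apply: eq_bigr => i _ /=.
  by rewrite mevalZ mulrC; congr (_ * _); rewrite mxE (tnth_nth z).
exists (fun j => l 0 j) => m hm.
have lt_m : (mdeg m < d.+1)%N by rewrite hm.
pose i := enum_rank (BMultinom lt_m).
have ei : e i = m by rewrite /e enum_rankK.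
have := congr1 (fun A : 'M_(_, _) => A 0 i) hl; rewrite !mxE /X ei hm eqxx => ->.
by apply: eq_bigr => j _; rewrite mxE /X ei hm eqxx.
Qed.

Lemma waring_of_border (F : numClosedFieldType) n d r N c (f : {mpoly F[n]})
    (Q : 'I_r -> 'I_n -> {poly F}) :
    (0 < d)%N -> f \is d.-homog -> c != 0 ->
    (forall m, mdeg m = d ->
      'X^(N.+1) %| (\sum_k linform (Q k) ^+ d)@_m - (c * f@_m) *: 'X^N) ->
  exists2 s, (s <= 'C(2 * r - 2, r - 1) * d)%N & waring_decomp d f s.
Proof.
move=> d0 hf c0 hQ; have [mu [mu0 hmu]] := linform_exp_coef n d.
pose one := fun _ : 'I_r => 1 : {poly F}.
have muF m : mdeg m = d -> (mu m)%:R != 0 :> F.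
  by move=> hm; rewrite pnatr_eq0 -lt0n mu0.
have coefE m : mdeg m = d ->
    (\sum_k linform (Q k) ^+ d)@_m = (mu m)%:R *: wsum Q one predT 'X_[m].
  move=> hm; rewrite raddf_sum scaler_sumr; apply: eq_bigr => k _ /=.
  by rewrite hmu // mul1r -mul_polyC polyC_natr.
have hN : wsum_dvd d Q one N predT.
  apply: wsum_dvdW => m hm; rewrite -(dvdpZr _ _ (muF m hm)) -coefE //.
  rewrite -[X in _ %| X](subrK ((c * f@_m) *: 'X^N)) dvdp_add ?dvdpZ //.
    exact: dvdp_trans (dvdp_exp2l _ (leqnSn N)) (hQ m hm).
  by rewrite -mul_polyC dvdp_mull.
have coefN (P : {poly F}) : 'X^(N.+1) %| P -> P`_N = 0.
  by case/dvdpP => q ->; rewrite coefMXn ltnSn.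
have [Z sZ hZ] := border_points d0 hN.
pose L (p : {mpoly F[n]}) := (wsum Q one predT (map_mpoly polyC p))`_N.
have linL a p q : L (a *: p + q) = a * L p + L q.
  by rewrite /L rmorphD /= map_mpolyZ wsumD wsumZ coefD coefCM.
have [|l hl] := dual_span (Z := Z) (d := d) linL.
  by move=> p hp pZ; apply/coefN/hZ.
exists (size Z) => //.
(* The coefficient [l j / c] of each power is absorbed into the linear form by a [d]-th root. *)
exists (fun j i => d.-root (l j / c) * tnth (in_tuple Z) j i).
have LX m : mdeg m = d -> L 'X_[m] = c * f@_m / (mu m)%:R.
  move=> hm; rewrite /L map_mpolyX; apply: (canRL (mulfK (muF m hm))).
  have := coefN _ (hQ m hm); rewrite coefB coefE // !coefZ coefXn eqxx mulr1.
  by rewrite mulrC => /eqP; rewrite subr_eq0 => /eqP.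
apply/mpolyP => m; have [hm|hm] := eqVneq (mdeg m) d; last first.
  rewrite (dhomog_nemf_coeff hf hm); symmetry; apply: dhomog_nemf_coeff hm.
  by apply: dhomog_sum => j _; apply: dhomog_tX.
have -> : f@_m = (mu m)%:R / c * L 'X_[m].
  by rewrite LX //; field; rewrite c0 muF.
rewrite hl // raddf_sum mulr_sumr; apply: eq_bigr => j _ /=.
have hX : ('X_[m] : {mpoly F[n]}) \is d.-homog by rewrite dhomogX /= hm.
rewrite hmu // (meval_dhomogZ _ _ hX).
by rewrite rootCK //; ring.
Qed.

(** * From limits to divisibility by powers of the parameter *)

Lemma horner_bound (F : numFieldType) (p : {poly F}) :
  exists2 K, 0 <= K & forall x, `|x| <= 1 -> `|p.[x]| <= K.
Proof.
exists (\sum_(i < size p) `|p`_i|) => [|x x1]; first exact: sumr_ge0.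
rewrite horner_coef; apply: le_trans (ler_norm_sum _ _ _) _.
apply: ler_sum => i _; rewrite normrM normrX ler_piMr //.
exact: exprn_ile1.
Qed.

(** Near 0, [p.[0]] differs from [p.[x]] by a multiple of [x], and [B] is bounded; it suffices to
    find one small enough [x] that is not a root of [q]. *)
Lemma horner0_small (F : numFieldType) (p q B : {poly F}) : q != 0 ->
    (forall e, 0 < e -> exists2 delta, 0 < delta & forall x, x != 0 ->
       `|x| < delta -> q.[x] != 0 -> `|p.[x]| <= e * `|B.[x]|) ->
  p.[0] = 0.
Proof.
move=> q0 small; apply: contraTeq isT => p0.
have /factor_theorem [g hg] : root (p - (p.[0])%:P) 0.
  by rewrite rootE hornerD hornerN hornerC subrr.
rewrite polyC0 subr0 in hg.
have pE x : p.[0] = p.[x] - g.[x] * x.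
  have := congr1 (horner^~ x) hg; rewrite /= !hornerE => <-.
  by rewrite opprB addrC subrK.
have [K K0 hK] := horner_bound g; have [L L0 hL] := horner_bound B.
pose h := `|p.[0]| / 2.
have h0 : 0 < h by rewrite divr_gt0 ?normr_gt0.
have L1 : 0 < L + 1 by rewrite ltr_wpDl.
have [delta delta0 hdelta] := small (h / (L + 1)) (divr_gt0 h0 L1).
(* Any positive [x <= s^-1] satisfies [x <= 1], [x < delta] and [K * x <= h] at once. *)
pose s := delta^-1 + 1 + K / h.
have d1 : 0 < delta^-1 by rewrite invr_gt0.
have Kh : 0 <= K / h by rewrite divr_ge0 // ltW.
have s0 : 0 < s by rewrite ltr_wpDr // addr_gt0.
have s1 : 1 <= s by rewrite /s -addrA addrCA lerDl addr_ge0 // ltW.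
have s_delta : delta^-1 < s by rewrite /s -addrA ltrDl ltr_wpDr.
have s_K : K / h <= s by rewrite /s lerDr addr_ge0 // ltW.
pose rs := [seq (s * k.+1%:R)^-1 | k <- iota 0 (size q)].
(* Among [size q] distinct candidates, one is not a root of [q]. *)
have /allPn [_ /mapP [k _ ->] qx] : ~~ all (root q) rs.
  apply: contra q0 => hrs; apply/eqP/(roots_geq_poly_eq0 hrs).
    rewrite map_inj_uniq ?iota_uniq // => x y /invr_inj.
    by move/(mulfI (lt0r_neq0 s0))/eqP; rewrite eqr_nat eqSS => /eqP.
  by rewrite size_map size_iota.
set x := (s * _)^-1 in qx.
have k1 : 1 <= k.+1%:R :> F by rewrite ler1n.
have sk0 : 0 < s * k.+1%:R by rewrite mulr_gt0 // ltr0n.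
have x0 : 0 < x by rewrite invr_gt0.
have le_xs : x <= s^-1 by rewrite lef_pV2 ?posrE // ler_peMr // ltW.
have nx : `|x| = x by rewrite gtr0_norm.
have x1 : `|x| <= 1 by rewrite nx (le_trans le_xs) // invf_le1.
have xd : `|x| < delta.
  by rewrite nx (le_lt_trans le_xs) // -[delta]invrK ltf_pV2 ?posrE.
have := hdelta x (lt0r_neq0 x0) xd qx => px.
have : `|p.[0]| < h + h.
  rewrite (pE x); apply: le_lt_trans (ler_normB _ _) _.
  apply: ltr_leD.
    apply: le_lt_trans px _; apply: (@le_lt_trans _ _ (h / (L + 1) * L)).
      by rewrite ler_wpM2l ?hL // ltW // divr_gt0.
    by rewrite mulrAC ltr_pdivrMr // ltr_pM2l // ltrDl.
  rewrite normrM nx; apply: (@le_trans _ _ (K * s^-1)).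
    by apply: ler_pM; rewrite ?normr_ge0 ?hK // ltW.
  by rewrite ler_pdivrMr // mulrC -ler_pdivrMr.
by rewrite /h -mulr2n -[X in _ < X]mulr_natr divfK ?pnatr_eq0 // ltxx.
Qed.

(** Factors ['X] are split off one at a time: for [j <= M], the quotient by ['X^j] is still small
    relative to [B * 'X^(M - j)], hence vanishes at 0. *)
Lemma dvdXn_small (F : numFieldType) (p q B : {poly F}) M : q != 0 ->
    (forall e, 0 < e -> exists2 delta, 0 < delta & forall x, x != 0 ->
       `|x| < delta -> q.[x] != 0 -> `|p.[x]| <= e * `|(B * 'X^M).[x]|) ->
  'X^(M.+1) %| p.
Proof.
move=> q0 small; suff: forall j, (j <= M.+1)%N -> 'X^j %| p by apply.
elim=> [|j IH] lt_jM; first by rewrite expr0 dvd1p.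
have /dvdpP [p' ep] := IH (ltnW lt_jM).
suff /factor_theorem [g eg] : root p' 0.
  by rewrite ep eg polyC0 subr0 -mulrA -exprS dvdp_mull.
rewrite rootE; apply/eqP/(@horner0_small _ _ q (B * 'X^(M - j)) q0) => e e0.
have [delta delta0 hd] := small e e0; exists delta => // x x0 xd qx.
have := hd x x0 xd qx; rewrite ep.
have -> : B * 'X^M = B * 'X^(M - j) * 'X^j by rewrite -mulrA -exprD subnK.
rewrite !(hornerM _ 'X^j) !normrM mulrA ler_pM2r //.
by rewrite hornerXn normr_gt0 expf_neq0.
Qed.

Lemma linform_horner (F : comNzRingType) n d (a : 'I_n -> {poly F}) m x :
  ((linform a ^+ d)@_m).[x] = (linform (fun i => (a i).[x]) ^+ d)@_m.
Proof.
rewrite -/(horner_eval x _) -mcoeff_map_mpoly rmorphXn /= /linform rmorph_sum /=.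
congr ((_ ^+ d)@_m); apply: eq_bigr => i _.
by rewrite map_mpolyZ map_mpolyX.
Qed.

(** Multiplying by a common denominator [D = D' * 'X^M] makes the forms polynomial and multiplies
    the sum by [D ^+ d], of leading term [D'.[0] ^+ d *: 'X^(M * d)]; this gives [N] and [c]. *)
Lemma border_decomp_poly (R : realType) n d r (f : {mpoly R[i][n]}) :
    border_decomp d f r ->
  exists N c (Q : 'I_r -> 'I_n -> {poly R[i]}), c != 0 /\
    forall m, 'X^(N.+1) %| (\sum_k linform (Q k) ^+ d)@_m - (c * f@_m) *: 'X^N.
Proof.
case=> l hl.
pose D : {poly R[i]} := \prod_k \prod_i rden (l k i).
have D0 : D != 0.
  by apply/prodf_neq0 => k _; apply/prodf_neq0 => i _; exact: rden_neq0.
have den_dvd k i : rden (l k i) %| D.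
  by rewrite /D (bigD1 k) //= (bigD1 i) //= -mulrA dvdp_mulr.
pose Q k i := rnum (l k i) * (D %/ rden (l k i)).
have den_ne x k i : D.[x] != 0 -> (rden (l k i)).[x] != 0.
  apply: contra => /eqP h; have /dvdpP [g ->] := den_dvd k i.
  by rewrite hornerM h mulr0.
have QE x k i : D.[x] != 0 -> (Q k i).[x] = D.[x] * reval (l k i) x.
  move=> /(den_ne x k i) h; rewrite hornerM /reval.
  have /(congr1 (horner^~ x)) := divpK (den_dvd k i).
  by rewrite /= hornerM => <-; field.
have [M [D' nroot eD]] := multiplicity_XsubC D 0.
rewrite D0 /= polyC0 subr0 in nroot eD.
have SE x m : D.[x] != 0 -> ((\sum_k linform (Q k) ^+ d)@_m - f@_m *: D ^+ d).[x] =
    D.[x] ^+ d * ((\sum_k linform (fun i => reval (l k i) x) ^+ d)@_m - f@_m).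
  move=> Dx; rewrite hornerD hornerN hornerZ horner_exp mulrBr.
  congr (_ - _); last by rewrite mulrC.
  rewrite !raddf_sum horner_sum /= mulr_sumr; apply: eq_bigr => k _ /=.
  rewrite linform_horner -mcoeffZ -exprZn -linformZ.
  congr ((_ ^+ d)@_m); rewrite /linform; apply: eq_bigr => i _.
  by rewrite QE.
exists (M * d)%N, (D'.[0] ^+ d), Q; split; first exact: expf_neq0.
move=> m; have hT : 'X^((M * d).+1) %| (\sum_k linform (Q k) ^+ d)@_m - f@_m *: D ^+ d.
  apply: (@dvdXn_small _ _ D (D' ^+ d)) => // e e0.
  (* In the order on complex numbers, a positive element is real. *)
  have [e' e'0 ee'] : exists2 e' : R, 0 < e' & e = (e'%:C)%C.
    by case: e e0 => a b; rewrite ltcE /= => /andP [/eqP -> a0]; exists a.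
  have [delta delta0 hd] := hl e' e'0.
  exists (delta%:C)%C => [|x x0 xd Dx]; first by rewrite ltcR.
  rewrite SE // normrM mulrC.
  have -> : D' ^+ d * 'X^(M * d) = D ^+ d by rewrite eD exprMn exprM.
  rewrite horner_exp ler_wpM2r // ltW // ee'; apply: hd => // k i.
  exact: den_ne.
(* Replacing [D' ^+ d] by its constant term costs a multiple of ['X]. *)
have -> : (\sum_k linform (Q k) ^+ d)@_m - (D'.[0] ^+ d * f@_m) *: 'X^(M * d) =
    ((\sum_k linform (Q k) ^+ d)@_m - f@_m *: D ^+ d) +
    (f@_m *: (D' ^+ d - (D'.[0] ^+ d)%:P)) * 'X^(M * d).
  rewrite eD exprMn -exprM -scalerAl mulrBl scalerBr mul_polyC scalerA.
  by rewrite [f@_m * _]mulrC addrA subrK.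
rewrite dvdp_add // exprS dvdp_mul //.
rewrite -mul_polyC dvdp_mull // -['X]subr0 -polyC0 dvdp_XsubCl rootE.
by rewrite !hornerE subrr.
Qed.

Theorem theorem14 (R : realType) (n d r : nat) (f : {mpoly R[i][n]}) :
  (0 < d)%N -> f \is d.-homog -> BWR_eq d f r ->
  WR_le d f ('C(2 * r - 2, r - 1) * d)%N.
Proof.
move=> d0 hf [/border_decomp_poly [N [c [Q [c0 hQ]]]] _].
exact: (waring_of_border d0 hf c0 (fun m _ => hQ m)).
Qed.
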